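(* Let $J_t:\mathcal{P}_t^2\to\mathbb{R}$ ($t=0,\dots,T-1$) be the value functions, and let $g_T^{*1},g_T^{*2}$ and $(\psi_t^{*[2,1]},g_t^{*2})$ ($t=0,\dots,T-1$) be the corresponding laws, of the dynamic program given in the context. For a strategy profile $\boldsymbol{g}$ let $\mathcal{J}_t(\boldsymbol{g})=\mathbb{E}^{\boldsymbol{g}}\big[\sum_{\ell=t}^T c_\ell(X_\ell,U_\ell^1,U_\ell^2)\big]$. Then for any $t=0,\dots,T-1$: 1) $\mathcal{J}_t(\boldsymbol{g})\ge\mathbb{E}^{\boldsymbol{g}}[J_t(\Pi_t^2)]$ for all $\boldsymbol{g}\in\mathcal{G}''$. 2) For all $\boldsymbol{g}\in\mathcal{G}''$, $$\mathcal{J}_t\big(\boldsymbol{g}_{0:t-1},g_t^{*1},g_t^{*2},\boldsymbol{g}^*_{t+1:T}\big)=\mathbb{E}^{\boldsymbol{g}}[J_t(\Pi_t^2)],$$ where $g_\ell^{*1}(\pi^1,\pi^2)=\psi_\ell^{*[2,1]}(\pi^2)(\pi^1)$ for $\ell=t,\dots,T-1$, $\boldsymbol{g}_\ell=(g_\ell^1,g_\ell^2)$, $\boldsymbol{g}^*_\ell=(g_\ell^{*1},g_\ell^{*2})$, and $\boldsymbol{g}_{0:t-1}=(\boldsymbol{g}_0,\dots,\boldsymbol{g}_{t-1})$.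
   Context: Team model. Fix $T\in\mathbb{N}$; time runs over $t=0,\dots,T$. The state $X_t$ takes values in a finite set $\mathcal{X}_t$. Agents $k\in\{1,2\}$ choose actions $U_t^k$ in finite sets $\mathcal{U}_t^k$ and receive observations $Y_t^k$ in finite sets $\mathcal{Y}_t^k$. The dynamics are $X_{t+1}=f_t(X_t,U_t^1,U_t^2,W_t)$ for $t=0,\dots,T-1$, and $Y_t^k=h_t^k(X_t,V_t^k)$ for $t=0,\dots,T$, where the disturbances $W_t$ and noises $V_t^k$ take values in finite sets. The primitive random variables $X_0$, $W_t$, $V_t^1$, $V_t^2$ ($t=0,\dots,T$) are mutually independent with known distributions. The cost functions are $c_t:\mathcal{X}_t\times\mathcal{U}_t^1\times\mathcal{U}_t^2\to\mathbb{R}_{\ge 0}$. Memories. $M_t^2=\{Y_{0:t}^2,U_{0:t-1}^2\}$, $M_t^1=\{Y_{0:t}^1,U_{0:t-1}^1,Y_{0:t}^2,U_{0:t-1}^2\}$, and $L_t^{[1,2]}=M_t^1\setminus M_t^2=\{Y_{0:t}^1,U_{0:t-1}^1\}$ with finite set of possible values $\mathcal{L}_t^{[1,2]}$. Information states. $\Pi_t^1=\mathbb{P}^{\boldsymbol g}(X_t\mid M_t^1)\in\mathcal{P}_t^1=\Delta(\mathcal{X}_t)$ and $\Pi_t^2=\mathbb{P}^{\boldsymbol g}(X_t,L_t^{[1,2]}\mid M_t^2)\in\mathcal{P}_t^2=\Delta(\mathcal{X}_t\times\mathcal{L}_t^{[1,2]})$ under the strategy profile in use (additionally conditioning $\Pi_t^2$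 on past prescriptions, which are functions of $M_t^2$, changes nothing). Strategies. $\mathcal{G}''$ is the set of strategy profiles $\boldsymbol{g}=(g_t^1,g_t^2)_{t=0}^T$ of the form $U_t^1=g_t^1(\Pi_t^1,\Pi_t^2)$, $U_t^2=g_t^2(\Pi_t^2)$. At time $T$, agent 1 may also use $U_T^2$, i.e. a law $\bar g_T^1(\Pi_T^1,\Pi_T^2,U_T^2)$; given $U_T^2=g_T^2(\Pi_T^2)$ this is the same as the law $(\pi^1,\pi^2)\mapsto\bar g_T^1(\pi^1,\pi^2,g_T^2(\pi^2))$, so such laws are also denoted $g_T^1$. A prescription is a function $\gamma:\mathcal{P}_t^1\to\mathcal{U}_t^1$; $\mathcal{F}_t^{[2,1]}$ is the set of these. Auxiliary functions. $e_t(\pi^2,l)(x)=\pi^2(x,l)/\sum_{x'}\pi^2(x',l)$ (an arbitrary fixed element of $\mathcal{P}_t^1$ if the denominator is $0$), so $\Pi_t^1=e_t(\Pi_t^2,L_t^{[1,2]})$. Let $\tilde c_t^1(\pi^1,u^1,u^2)=\sum_{x}\pi^1(x)\,c_t(x,u^1,u^2)$ and $\tilde c_t^2(\pi^2,\gamma,u^2)=\sum_{x,l}\pi^2(x,l)\,\tilde c_t^1\big(e_t(\pi^2,l),\gamma(e_t(\pi^2,l)),u^2\big)$. One-step update: given $(\pi^2,\gamma,u^2)$, let $(X_t,L_t^{[1,2]})\sim\pi^2$ be independent of $(W_t,V_{t+1}^1,V_{t+1}^2)$, $U_t^1=\gamma(e_t(\pi^2,L_t^{[1,2]}))$, $U_t^2=u^2$,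 $X_{t+1}=f_t(X_t,U_t^1,U_t^2,W_t)$, $Y_{t+1}^k=h_{t+1}^k(X_{t+1},V_{t+1}^k)$, $L_{t+1}^{[1,2]}=L_t^{[1,2]}\cup\{Y_{t+1}^1,U_t^1\}$; then $\Pi_{t+1}^2$ is the conditional distribution of $(X_{t+1},L_{t+1}^{[1,2]})$ given $Z_{t+1}^2=\{Y_{t+1}^2,U_t^2\}$, and $\mathbb{E}[\,\cdot\mid\pi^2,\gamma,u^2]$ is expectation in this experiment. Dynamic program. $$J_T^1(\pi_T^1,u_T^2)=\inf_{u_T^1\in\mathcal{U}_T^1}\tilde c_T^1(\pi_T^1,u_T^1,u_T^2),$$ $$J_T^2(\pi_T^2)=\inf_{u_T^2\in\mathcal{U}_T^2}\mathbb{E}[J_T^1(\Pi_T^1,u_T^2)\mid\pi_T^2,u_T^2]=\inf_{u_T^2\in\mathcal{U}_T^2}\sum_{x,l}\pi_T^2(x,l)\,J_T^1(e_T(\pi_T^2,l),u_T^2),$$ with $u_T^1=g_T^{*1}(\pi_T^1,u_T^2)$ and $u_T^2=g_T^{*2}(\pi_T^2)$ being minimizers. With the convention $J_T=J_T^2$, for $t=T-1,\dots,0$, $$J_t(\pi_t^2)=\inf_{u_t^2\in\mathcal{U}_t^2,\ \gamma\in\mathcal{F}_t^{[2,1]}}\Big\{\tilde c_t^2(\pi_t^2,\gamma,u_t^2)+\mathbb{E}\big[J_{t+1}(\Pi_{t+1}^2)\mid\pi_t^2,\gamma,u_t^2\big]\Big\},$$ with $(\gamma,u_t^2)=(\psi_t^{*[2,1]}(\pi_t^2),g_t^{*2}(\pi_t^2))$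 a minimizing pair. *)

(* Defs.v *)
From HB Require Import structures.
From mathcomp Require Import all_boot all_order all_algebra.
From mathcomp Require Import all_classical all_reals all_analysis.

Set Implicit Arguments.
Unset Strict Implicit.
Unset Printing Implicit Defensive.
Import Order.TTheory GRing.Theory Num.Theory.
Local Open Scope classical_set_scope.
Local Open Scope ring_scope.

(* Delta(S), the probability distributions on a finite set S. *)
Section Simplex.
Variables (R : realType) (S : finType).

Definition is_dist (p : {ffun S -> R}) : bool :=
  [forall s, 0 <= p s] && (\sum_s p s == 1).

Record dist := Dist { dist_val :> {ffun S -> R}; _ : is_dist dist_val }.

HB.instance Definition _ := [isSub for dist_val].

End Simplex.

(* Conditional distributions are built with [insubd dflt q], which is q when q
   is a distribution and dflt otherwise.  As x / 0 = 0, a quotient by the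
   probability of a null event is the zero function, hence yields dflt; in all
   other cases the quotient is a distribution. *)

Definition Pr (R : realType) (d : measure_display) (Omega : measurableType d)
  (P : probability Omega R) (E : set Omega) : R := fine (P E).

Definition cond_dist (R : realType) (d : measure_display)
    (Omega : measurableType d) (P : probability Omega R) (A B : finType)
    (dflt : dist R A) (X : Omega -> A) (Y : Omega -> B) (b : B) : dist R A :=
  insubd dflt [ffun a =>
    Pr P [set w | X w = a /\ Y w = b] / Pr P [set w | Y w = b]].

Definition fin_cond_dist (R : realType) (O A B : finType) (dflt : dist R A)
    (p : O -> R) (X : O -> A) (Y : O -> B) (b : B) : dist R A :=
  insubd dflt [ffun a =>
    (\sum_(o | (X o == a) && (Y o == b)) p o) / \sum_(o | Y o == b) p o].

Definition minimizer (R : realType) (A : Type) (F : A -> R) (a : A) : Prop :=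
  forall b, F a <= F b.

(* Families are indexed by all of nat; only the data at times t <= horizon
   (t < horizon for the dynamics) matter. *)
Record team (R : realType) := Team {
  horizon : nat;
  state : nat -> finType;
  act1 : nat -> finType;
  act2 : nat -> finType;
  obs1 : nat -> finType;
  obs2 : nat -> finType;
  dstb : nat -> finType;
  noise1 : nat -> finType;
  noise2 : nat -> finType;
  dyn : forall t, state t -> act1 t -> act2 t -> dstb t -> state t.+1;
  sense1 : forall t, state t -> noise1 t -> obs1 t;
  sense2 : forall t, state t -> noise2 t -> obs2 t;
  cost : forall t, state t -> act1 t -> act2 t -> R;
  cost_ge0 : forall t x u1 u2, (t <= horizon)%N -> 0 <= @cost t x u1 u2
}.

(* The sets in the independence condition range over all subsets, the full ones
   included, so the product rule covers every subfamily. *)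
Record primitives (R : realType) (M : team R) (d : measure_display)
    (Omega : measurableType d) (P : probability Omega R) := Primitives {
  rX0 : Omega -> state M 0;
  rW : forall t, Omega -> dstb M t;
  rV1 : forall t, Omega -> noise1 M t;
  rV2 : forall t, Omega -> noise2 M t;
  measurable_rX0 : forall x, measurable (rX0 @^-1` [set x]);
  measurable_rW : forall t x, measurable (@rW t @^-1` [set x]);
  measurable_rV1 : forall t x, measurable (@rV1 t @^-1` [set x]);
  measurable_rV2 : forall t x, measurable (@rV2 t @^-1` [set x]);
  primitives_independent :
    forall (A0 : set (state M 0)) (AW : forall t, set (dstb M t))
           (A1 : forall t, set (noise1 M t)) (A2 : forall t, set (noise2 M t)),
    Pr P [set w | A0 (rX0 w) /\ forall t, (t <= horizon M)%N ->
                  [/\ AW t (rW t w), A1 t (rV1 t w) & A2 t (rV2 t w)]] =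
    Pr P (rX0 @^-1` A0) *
    \prod_(t < (horizon M).+1)
      (Pr P (@rW t @^-1` AW t) * Pr P (@rV1 t @^-1` A1 t) *
       Pr P (@rV2 t @^-1` A2 t))
}.

(* Values of (Y_{0:t}, U_{0:t-1}), nested as ((history up to t, U_t), Y_{t+1}). *)
Fixpoint history (Y U : nat -> finType) (t : nat) : finType :=
  if t is s.+1 then (history Y U s * U s * Y s.+1)%type else Y 0%N.

Section Team.
Variables (R : realType) (M : team R).

Definition priv (t : nat) : finType := history (obs1 M) (act1 M) t.
Definition mem2 (t : nat) : finType := history (obs2 M) (act2 M) t.

Definition info1 (t : nat) := dist R (state M t).
Definition info2 (t : nat) := dist R (state M t * priv t)%type.

Definition prescription (t : nat) := info1 t -> act1 M t.

Record profile := Profile {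
  law1 : forall t, info1 t -> info2 t -> act1 M t;
  law2 : forall t, info2 t -> act2 M t
}.

(* The profile (g_{0:t-1}, g'_{t:T}). *)
Definition splice (t : nat) (g g' : profile) : profile := {|
  law1 := fun l => if (l < t)%N then @law1 g l else @law1 g' l;
  law2 := fun l => if (l < t)%N then @law2 g l else @law2 g' l
|}.

(* dflt1 and dflt2 are the arbitrary values of the information states when the
   conditioning event is null. *)
Variables (dflt1 : forall t, info1 t) (dflt2 : forall t, info2 t).
Variables (d : measure_display) (Omega : measurableType d).
Variables (P : probability Omega R) (prim : primitives M P).

Section Beliefs.
Variables (t : nat) (Z : Omega -> (state M t * priv t * mem2 t)%type).

Definition belief1 (w : Omega) : info1 t :=
  cond_dist P (dflt1 t) (fun w' => (Z w').1.1)
    (fun w' => ((Z w').1.2, (Z w').2)) ((Z w).1.2, (Z w).2).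

Definition belief2 (w : Omega) : info2 t :=
  cond_dist P (dflt2 t) (fun w' => (Z w').1) (fun w' => (Z w').2) (Z w).2.

End Beliefs.

(* The process (X_t, L_t, M_t^2) under g.  The recursion is on the random
   variable, since the information states depend on its law. *)
Fixpoint process (g : profile) (t : nat) :
    Omega -> (state M t * priv t * mem2 t)%type :=
  match t with
  | 0 => fun w =>
      let x := rX0 prim w in
      (x, sense1 x (rV1 prim 0 w), sense2 x (rV2 prim 0 w))
  | s.+1 => let Z := process g s in fun w =>
      let u1 := law1 g (belief1 Z w) (belief2 Z w) in
      let u2 := law2 g (belief2 Z w) in
      let x := dyn (Z w).1.1 u1 u2 (rW prim s w) in
      (x, ((Z w).1.2, u1, sense1 x (rV1 prim s.+1 w)),
          ((Z w).2, u2, sense2 x (rV2 prim s.+1 w)))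
  end.

Section Trajectory.
Variables (g : profile) (t : nat) (w : Omega).
Definition Xproc : state M t := (process g t w).1.1.
Definition Pi1 : info1 t := belief1 (process g t) w.
Definition Pi2 : info2 t := belief2 (process g t) w.
Definition U1proc : act1 M t := law1 g Pi1 Pi2.
Definition U2proc : act2 M t := law2 g Pi2.
End Trajectory.

Definition cost_to_go (g : profile) (t : nat) : \bar R :=
  ('E_P[fun w => (\sum_(t <= l < (horizon M).+1)
                   cost (Xproc g l w) (U1proc g l w) (U2proc g l w))%R])%E.

Definition e_map (t : nat) (pi2 : info2 t) (l : priv t) : info1 t :=
  insubd (dflt1 t) [ffun x => pi2 (x, l) / \sum_x' pi2 (x', l)].

Definition ctilde1 (t : nat) (pi1 : info1 t) (u1 : act1 M t) (u2 : act2 M t) : R :=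
  \sum_x pi1 x * cost x u1 u2.

Definition ctilde2 (t : nat) (pi2 : info2 t) (gamma : prescription t)
    (u2 : act2 M t) : R :=
  \sum_(xl : state M t * priv t)
    pi2 xl * ctilde1 (e_map pi2 xl.2) (gamma (e_map pi2 xl.2)) u2.

(* One-step experiment: outcomes ((X_t, L_t), W_t, V_{t+1}^1, V_{t+1}^2), with
   (X_t, L_t) ~ pi2 independent of the disturbance and the noises. *)
Section OneStep.
Variables (t : nat) (pi2 : info2 t) (gamma : prescription t) (u2 : act2 M t).

Definition outcome : finType :=
  (state M t * priv t * dstb M t * noise1 M t.+1 * noise2 M t.+1)%type.

Definition outcome_mass (o : outcome) : R :=
  let: (x, l, a, v1, v2) := o in
  pi2 (x, l) * Pr P (rW prim t @^-1` [set a]) *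
  Pr P (rV1 prim t.+1 @^-1` [set v1]) * Pr P (rV2 prim t.+1 @^-1` [set v2]).

Definition step_act1 (o : outcome) : act1 M t :=
  let: (x, l, a, v1, v2) := o in gamma (e_map pi2 l).

Definition step_state (o : outcome) : state M t.+1 :=
  let: (x, l, a, v1, v2) := o in dyn x (step_act1 o) u2 a.

Definition step_priv (o : outcome) : priv t.+1 :=
  let: (x, l, a, v1, v2) := o in
  (l, step_act1 o, sense1 (step_state o) v1).

Definition step_Z2 (o : outcome) : obs2 M t.+1 * act2 M t :=
  let: (x, l, a, v1, v2) := o in (sense2 (step_state o) v2, u2).

Definition step_info2 (o : outcome) : info2 t.+1 :=
  fin_cond_dist (dflt2 t.+1) outcome_mass
    (fun o' => (step_state o', step_priv o')) step_Z2 (step_Z2 o).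

(* E[J(Pi_{t+1}^2) | pi2, gamma, u2] *)
Definition step_expect (J : info2 t.+1 -> R) : R :=
  \sum_o outcome_mass o * J (step_info2 o).

Definition bellman (J : info2 t.+1 -> R) : R :=
  ctilde2 pi2 gamma u2 + step_expect J.

End OneStep.

(* The functions J_T^1 and (pi2, u2) |-> E[J_T^1(Pi_T^1, u2) | pi2, u2], at
   t = T; they are typed at every t so that value_rec needs no cast. *)
Definition term_value1 (t : nat) (pi1 : info1 t) (u2 : act2 M t) : R :=
  inf (range (fun u1 => ctilde1 pi1 u1 u2)).

Definition term_expect (t : nat) (pi2 : info2 t) (u2 : act2 M t) : R :=
  \sum_(xl : state M t * priv t) pi2 xl * term_value1 (e_map pi2 xl.2) u2.

(* value_rec k t is the value function at time t with k stages to go. *)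
Fixpoint value_rec (k t : nat) : info2 t -> R :=
  if k is k'.+1 then
    fun pi2 => inf (range (fun a : prescription t * act2 M t =>
                             bellman pi2 a.1 a.2 (@value_rec k' t.+1)))
  else fun pi2 => inf (range (term_expect pi2)).

Definition value (t : nat) : info2 t -> R := @value_rec (horizon M - t) t.

(* psi : the prescription laws psi_t^*, t < T;  gT : the law (pi1, u2) |->
   g_T^{*1}(pi1, u2);  gs : the profile g^*, whose agent-1 laws are derived from
   psi (t < T) and from gT with u2 = g_T^{*2}(pi2) (t = T). *)
Record dp_solution (psi : forall t, info2 t -> prescription t)
    (gT : info1 (horizon M) -> act2 M (horizon M) -> act1 M (horizon M))
    (gs : profile) : Prop := DpSolution {
  dp_term1 : forall pi1 u2, minimizer (fun u1 => ctilde1 pi1 u1 u2) (gT pi1 u2);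
  dp_term2 : forall pi2 : info2 (horizon M),
    minimizer (term_expect pi2) (law2 gs pi2);
  dp_stage : forall t (pi2 : info2 t), (t < horizon M)%N ->
    minimizer (fun a : prescription t * act2 M t =>
                 bellman pi2 a.1 a.2 (@value t.+1))
      (psi t pi2, law2 gs pi2);
  dp_law1_term : forall (pi1 : info1 (horizon M)) (pi2 : info2 (horizon M)),
    law1 gs pi1 pi2 = gT pi1 (law2 gs pi2);
  dp_law1 : forall t (pi1 : info1 t) (pi2 : info2 t), (t < horizon M)%N ->
    law1 gs pi1 pi2 = psi t pi2 pi1
}.

End Team.

(* Main.v *)
Require Import Defs.
From HB Require Import structures.
From mathcomp Require Import all_boot all_order all_algebra.
From mathcomp Require Import all_classical all_reals all_analysis.
From mathcomp Require Import ring.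

Set Implicit Arguments.
Unset Strict Implicit.
Unset Printing Implicit Defensive.
Import Order.TTheory GRing.Theory Num.Theory.
Local Open Scope classical_set_scope.
Local Open Scope ring_scope.

(** The value functions lower-bound the cost by backward induction on time, and
the induction rests on one identity ([stage_bellman]).  Put
gamma_m = g^1_t(., pi_m) and u2_m = g^2_t(pi_m), where pi_m is the value of
Pi^2_t on the event M^2_t = m.  Then, for every function J and every t < T,

  E[c_t] + E[J(Pi^2_{t+1})]
    = sum over m of P(M^2_t = m) * bellman(pi_m, gamma_m, u2_m, J).

With J the value function of time t+1, each Bellman term on the right is at
least the value function of time t at pi_m, with equality when gamma_m and u2_m
come from the dynamic program.  Adding the same inequality for the later stages
gives the first claim, and the case of equality gives the second, because
replacing the laws from time t on does not change Pi^2_t.  The induction starts at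
the horizon with the stage cost alone: there the optimal reaction of agent 1 to
its own belief and u2 is at least as good as any prescription
([value_term_le_ctilde2]).

The two summands of the identity are treated separately.

- The stage cost ([stage_costE]) uses P(x, l, m) = P(m) pi_m(x, l) and
  Pi^1_t = e_t(pi_m, l).  The latter holds on every memory of positive
  probability because conditioning only depends on the joint mass up to a
  constant factor ([normalizeZ]): the joint mass x |-> P(x, l, m) is P(m) times
  x |-> pi_m(x, l).  This includes the null values of l, where both sides are
  the same default distribution.

- The continuation value ([next_value_step_expect]) needs two facts.  First, the
  pair (one-step experiment, M^2_t) has mass P(m) * outcome_mass(pi_m): the
  process up to time t is a function of the primitives that have already been
  drawn, so it is independent of W_t, V^1_{t+1} and V^2_{t+1}
  ([process_past_independent], [mass_draw]).  Second, Pi^2_{t+1} is the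
  posterior of the one-step experiment started at pi_m ([belief2_step]), again
  by invariance of conditioning under the factor P(m).

Memories of probability zero, where the beliefs are arbitrary, carry weight zero
in all these sums.  Everything observable takes finitely many values, so that
expectations are finite sums ([expectation_fin_rv]) whatever the sample space,
and every infimum is a minimum because the dynamic program has a solution. *)

(** * Random variables with finitely many values *)

Section FiniteRandomVariables.
Variables (R : realType) (d : measure_display) (Omega : measurableType d).
Variable P : probability Omega R.

Definition fin_rv (A : finType) (Z : Omega -> A) :=
  forall a, measurable (Z @^-1` [set a]).

Definition mass (A : finType) (Z : Omega -> A) (a : A) : R :=
  Pr P (Z @^-1` [set a]).

Lemma Pr_ge0 (E : set Omega) : 0 <= Pr P E.
Proof. exact: fine_ge0. Qed.

Lemma mass_ge0 (A : finType) (Z : Omega -> A) a : 0 <= mass Z a.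
Proof. exact: Pr_ge0. Qed.

Lemma Pr_setT : Pr P setT = 1.
Proof. by rewrite /Pr probability_setT. Qed.

Lemma fin_rv_preimage (A : finType) (Z : Omega -> A) (B : set A) :
  fin_rv Z -> measurable (Z @^-1` B).
Proof.
move=> mZ; rewrite (_ : Z @^-1` B = \bigcup_(a in B) (Z @^-1` [set a])).
  by apply: fin_bigcup_measurable => // a _; exact: mZ.
by apply/seteqP; split=> [w Bw|w [a Ba /= aE]]; [exists (Z w) | rewrite /= aE].
Qed.

Lemma fin_rv_comp (A B : finType) (Z : Omega -> A) (F : A -> B) :
  fin_rv Z -> fin_rv (fun w => F (Z w)).
Proof. by move=> mZ b; exact: (fin_rv_preimage (F @^-1` [set b]) mZ). Qed.

Lemma fin_rv_pair (A B : finType) (Y : Omega -> A) (Z : Omega -> B) :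
  fin_rv Y -> fin_rv Z -> fin_rv (fun w => (Y w, Z w)).
Proof.
move=> mY mZ [a b].
rewrite (_ : _ @^-1` _ = (Y @^-1` [set a]) `&` (Z @^-1` [set b])).
  exact: measurableI.
by apply/seteqP; split=> w /= [-> ->].
Qed.

(** The event E is a parameter so that a finite variable can be summed out of
a joint event with variables that are still to be drawn. *)
Lemma Pr_split (A : finType) (Z : Omega -> A) (B : pred A) (E : set Omega) :
  fin_rv Z -> measurable E ->
  Pr P [set w | B (Z w) /\ E w] =
  \sum_(a | B a) Pr P [set w | Z w = a /\ E w].
Proof.
move=> mZ mE.
have mZE a : measurable [set w | Z w = a /\ E w].
  exact: (measurableI _ _ (mZ a) mE).
rewrite (_ : [set w | B (Z w) /\ E w] =
   \bigcup_(a in [set` enum B]) [set w | Z w = a /\ E w]); last first.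
  apply/seteqP; split=> w /= [].
    by move=> Bw Ew; exists (Z w) => //=; rewrite mem_enum.
  by move=> a /=; rewrite mem_enum => Ba [-> Ew].
rewrite /Pr measure_fin_bigcup //; last first.
  by move=> a b _ _ [w [[<- _] [<- _]]].
rewrite -(fsbig_seq _ _ (enum_uniq B)) /= big_enum /=.
have fE a : P [set w | Z w = a /\ E w] \is a fin_num by exact: fin_num_measure.
rewrite (eq_bigr (fun a => (fine (P [set w | Z w = a /\ E w]))%:E)).
  by rewrite sumEFin.
by move=> a _; rewrite fineK.
Qed.

Lemma Pr_event (A : finType) (Z : Omega -> A) (B : pred A) :
  fin_rv Z -> Pr P [set w | B (Z w)] = \sum_(a | B a) mass Z a.
Proof.
move=> mZ; have := Pr_split B mZ (@measurableT _ Omega).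
rewrite (_ : [set w | B (Z w) /\ _] = [set w | B (Z w)]) => [->|].
  apply: eq_bigr => a _; congr Pr.
  by apply/seteqP; split=> w //= [].
by apply/seteqP; split=> w //= [].
Qed.

Lemma mass_comp (A B : finType) (Z : Omega -> A) (F : A -> B) b :
  fin_rv Z -> mass (fun w => F (Z w)) b = \sum_(a | F a == b) mass Z a.
Proof.
move=> mZ; rewrite -(Pr_event (fun a => F a == b) mZ); congr Pr.
by apply/seteqP; split=> w /= /eqP.
Qed.

Lemma sum_mass_comp (A B : finType) (Z : Omega -> A) (F : A -> B) (f : B -> R) :
  fin_rv Z ->
  \sum_b mass (fun w => F (Z w)) b * f b = \sum_a mass Z a * f (F a).
Proof.
move=> mZ; rewrite (partition_big F xpredT) //=; apply: eq_bigr => b _.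
by rewrite mass_comp // mulr_suml; apply: eq_bigr => a /eqP ->.
Qed.

Lemma fin_rv_decomp (A : finType) (Z : Omega -> A) (f : A -> R) :
  (fun w => (f (Z w))%:E) =
  (fun w => \sum_(a : A) ((f a)%:E * (\1_(Z @^-1` [set a]) w)%:E)%E).
Proof.
apply/funext => w; rewrite (bigD1 (Z w)) //= big1 => [|a naZ].
  by rewrite indicE mem_set // mule1 adde0.
by rewrite indicE memNset ?mule0 // => /= e; rewrite -e eqxx in naZ.
Qed.

Lemma integrable_fin_rv (A : finType) (Z : Omega -> A) (f : A -> R) :
  fin_rv Z -> P.-integrable setT (fun w => (f (Z w))%:E).
Proof.
move=> mZ; rewrite fin_rv_decomp; apply: integrable_sum => // a _.
by apply: integrableZl => //; exact: integrable_indic.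
Qed.

Lemma expectation_fin_rv (A : finType) (Z : Omega -> A) (f : A -> R) :
  fin_rv Z -> ('E_P[fun w => f (Z w)] = (\sum_a mass Z a * f a)%:E)%E.
Proof.
move=> mZ; rewrite unlock fin_rv_decomp integral_sum // => [|a]; last first.
  by apply: integrableZl => //; exact: integrable_indic.
rewrite -sumEFin; apply: eq_bigr => a _.
rewrite integralZl //; last exact: integrable_indic.
by rewrite integral_indic // setIT mulrC EFinM /mass /Pr fineK ?fin_num_measure.
Qed.

Lemma expectation_sum_fin_rv (A : nat -> finType) (Z : forall i, Omega -> A i)
    (f : forall i, A i -> R) (m n : nat) :
  (forall i, fin_rv (Z i)) ->
  ('E_P[fun w => (\sum_(m <= i < n) f i (Z i w))%R] =
   (\sum_(m <= i < n) \sum_a mass (Z i) a * f i a)%:E)%E.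
Proof.
move=> mZ; rewrite unlock.
under eq_integral do rewrite -sumEFin.
rewrite integral_sum // => [|i]; last exact: integrable_fin_rv.
rewrite -sumEFin; apply: eq_bigr => i _.
by rewrite -expectation_fin_rv // unlock.
Qed.

End FiniteRandomVariables.

(** * Conditioning as normalization *)

Section Normalization.
Variables (R : realType).

Definition normalize (A : finType) (dflt : dist R A) (q : A -> R) : dist R A :=
  insubd dflt [ffun a => q a / \sum_a' q a'].

(** The factorization also holds when the total mass is zero, whatever the
default is: then q vanishes everywhere.  This is what makes null events harmless
in all later sums. *)
Lemma normalizeM (A : finType) (dflt : dist R A) (q : A -> R) a :
  (forall a, 0 <= q a) -> q a = (\sum_a' q a') * normalize dflt q a.
Proof.
move=> q0; have [s0|sN0] := eqVneq (\sum_a' q a') 0.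
  by rewrite s0 mul0r; apply/eqP; rewrite (psumr_eq0P _ s0).
rewrite /normalize insubdK ?ffunE; first by rewrite mulrC divfK.
rewrite unfold_in /is_dist; apply/andP; split.
  by apply/forallP => b; rewrite ffunE divr_ge0 ?sumr_ge0.
by under eq_bigr do rewrite ffunE; rewrite -mulr_suml divff.
Qed.

(** All identities between beliefs come from this invariance: two posteriors
agree, defaults included, as soon as their joint masses are proportional. *)
Lemma normalizeZ (A : finType) (dflt : dist R A) (k : R) (q q' : A -> R) :
  k != 0 -> (forall a, q' a = k * q a) ->
  normalize dflt q' = normalize dflt q.
Proof.
move=> k0 /funext ->; congr insubd; apply/ffunP => a; rewrite !ffunE.
by rewrite -mulr_sumr -mulf_div divff // mul1r.
Qed.

Lemma dist_ge0 (A : finType) (p : dist R A) a : 0 <= p a.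
Proof. by case: p => p /= /andP[/forallP]. Qed.

(** The marginal of Y in the denominator is the sum of the joint masses, so a
conditional distribution is a function of the joint mass alone. *)
Lemma cond_distE (d : measure_display) (Omega : measurableType d)
    (P : probability Omega R) (A B : finType) (dflt : dist R A)
    (X : Omega -> A) (Y : Omega -> B) b :
  fin_rv X -> fin_rv Y ->
  cond_dist P dflt X Y b =
  normalize dflt (fun a => mass P (fun w => (X w, Y w)) (a, b)).
Proof.
move=> mX mY; congr insubd; apply/ffunP => a; rewrite !ffunE.
have e a' : Pr P [set w | X w = a' /\ Y w = b] =
    mass P (fun w => (X w, Y w)) (a', b).
  by congr Pr; apply/seteqP; split=> w /= [-> ->].
rewrite e; congr (_ / _); under [RHS]eq_bigr do rewrite -e.
rewrite -(Pr_split P xpredT mX (mY b)); congr Pr.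
by apply/seteqP; split=> w //= [].
Qed.

Lemma fin_cond_distE (O A B : finType) (dflt : dist R A) (p : O -> R)
    (X : O -> A) (Y : O -> B) b :
  fin_cond_dist dflt p X Y b =
  normalize dflt (fun a => \sum_(o | (X o == a) && (Y o == b)) p o).
Proof.
congr insubd; apply/ffunP => a; rewrite !ffunE; congr (_ / _).
rewrite (partition_big X xpredT) //=; apply: eq_bigr => a' _.
by apply: eq_bigl => o; rewrite andbC.
Qed.

End Normalization.

(** * Independence of the past and the coming disturbances *)

Section PinCoordinate.
Variables (R : realType) (d : measure_display) (Omega : measurableType d).
Variables (P : probability Omega R) (S : nat -> finType).

(** Shrinking one unconstrained coordinate of a box to a point turns the event
that the coordinate takes this value into part of the box, and multiplies the
product mass by the mass of the point ([pin_coordinate_prod]).  In this way the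
product rule for boxes yields joint masses of single primitives with boxes in
the others. *)
Lemma pin_coordinate_event (X : forall s, Omega -> S s) (A : forall s, set (S s))
    (N t : nat) (a : S t) w :
  (t <= N)%N -> A t = setT ->
  (forall s, (s <= N)%N -> dfwith A t [set a] s (X s w)) <->
  X t w = a /\ forall s, (s <= N)%N -> A s (X s w).
Proof.
move=> tN At; split=> [H|[e H] s sN].
  split=> [|s sN]; first by have := H t tN; rewrite dfwithin.
  have := H s sN; have [<- _|ts] := eqVneq t s.
    by rewrite At.
  by rewrite dfwithout.
have [<-|ts] := eqVneq t s; first by rewrite dfwithin.
by rewrite dfwithout //; exact: H.
Qed.

Lemma pin_coordinate_prod (X : forall s, Omega -> S s) (A : forall s, set (S s))
    (N t : nat) (a : S t) :
  (t <= N)%N -> A t = setT ->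
  \prod_(s < N.+1) Pr P (X s @^-1` dfwith A t [set a] s) =
  mass P (X t) a * \prod_(s < N.+1) Pr P (X s @^-1` A s).
Proof.
move=> tN At; have tN1 : (t < N.+1)%N by [].
rewrite (bigD1 (Ordinal tN1)) //= [in RHS](bigD1 (Ordinal tN1)) //= dfwithin At preimage_setT Pr_setT.
rewrite mul1r; congr (_ * _); apply: eq_bigr => s st.
by rewrite dfwithout // eq_sym.
Qed.

End PinCoordinate.

Section Process.
Variables (R : realType) (M : team R).
Variables (dflt1 : forall t, info1 M t) (dflt2 : forall t, info2 M t).
Variables (d : measure_display) (Omega : measurableType d).
Variables (P : probability Omega R) (prim : primitives M P) (g : profile M).

Local Notation T := (horizon M).
Local Notation Z := (process dflt1 dflt2 prim g).

Definition belief1_at t (lm : priv M t * Defs.mem2 M t) : info1 M t :=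
  cond_dist P (dflt1 t) (fun w => (Z t w).1.1)
    (fun w => ((Z t w).1.2, (Z t w).2)) lm.

Definition belief2_at t (m : Defs.mem2 M t) : info2 M t :=
  cond_dist P (dflt2 t) (fun w => (Z t w).1) (fun w => (Z t w).2) m.

(** The outcome of the one-step experiment as realized by the process, with the
memory of agent 2 kept aside: given the memory, the first component is
distributed as the experiment started at the current belief. *)
Definition draw t (w : Omega) : outcome M t * Defs.mem2 M t :=
  ((Z t w).1, rW prim t w, rV1 prim t.+1 w, rV2 prim t.+1 w, (Z t w).2).

Definition transition t (q : outcome M t * Defs.mem2 M t) :
    state M t.+1 * priv M t.+1 * Defs.mem2 M t.+1 :=
  let: (x, l, a, v1, v2, m) := q in
  let u1 := law1 g (belief1_at (l, m)) (belief2_at m) in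
  let u2 := law2 g (belief2_at m) in
  let x' := dyn x u1 u2 a in
  (x', (l, u1, sense1 x' v1), (m, u2, sense2 x' v2)).

Lemma process_succ t w : Z t.+1 w = transition (draw t w).
Proof.
rewrite [LHS]/= /transition /draw /belief1 /belief2 /belief1_at /belief2_at.
by case: (Z t w) => [[x l] m].
Qed.

Lemma fin_rv_W t : fin_rv (rW prim t).
Proof. by move=> a; exact: measurable_rW. Qed.

Lemma fin_rv_V1 t : fin_rv (rV1 prim t).
Proof. by move=> a; exact: measurable_rV1. Qed.

Lemma fin_rv_V2 t : fin_rv (rV2 prim t).
Proof. by move=> a; exact: measurable_rV2. Qed.

Lemma fin_rv_draw_of_process t : fin_rv (Z t) -> fin_rv (draw t).
Proof.
move=> mZ; do !apply: fin_rv_pair.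
- exact: (fin_rv_comp fst mZ).
- exact: fin_rv_W.
- exact: fin_rv_V1.
- exact: fin_rv_V2.
- exact: (fin_rv_comp snd mZ).
Qed.

Definition initial_draw (w : Omega) : state M 0 * noise1 M 0 * noise2 M 0 :=
  (rX0 prim w, rV1 prim 0 w, rV2 prim 0 w).

Definition initial (q : state M 0 * noise1 M 0 * noise2 M 0) :
    state M 0 * priv M 0 * Defs.mem2 M 0 :=
  (q.1.1, sense1 q.1.1 q.1.2, sense2 q.1.1 q.2).

Lemma fin_rv_initial_draw : fin_rv initial_draw.
Proof.
do !apply: fin_rv_pair; [|exact: fin_rv_V1|exact: fin_rv_V2].
by move=> x; exact: measurable_rX0.
Qed.

Lemma fin_rv_process t : fin_rv (Z t).
Proof.
elim: t => [|t mZ]; first exact: (fin_rv_comp initial fin_rv_initial_draw).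
rewrite (_ : Z t.+1 = fun w => transition (draw t w)).
  by apply: fin_rv_comp; exact: fin_rv_draw_of_process.
by apply/funext => w; exact: process_succ.
Qed.

Lemma fin_rv_draw t : fin_rv (draw t).
Proof. exact: fin_rv_draw_of_process (@fin_rv_process t). Qed.

Definition in_box (AW : forall t, set (dstb M t))
    (A1 : forall t, set (noise1 M t)) (A2 : forall t, set (noise2 M t)) (w : Omega) : Prop := forall s, (s <= T)%N ->
  [/\ AW s (rW prim s w), A1 s (rV1 prim s w) & A2 s (rV2 prim s w)].

Definition box_mass (AW : forall t, set (dstb M t))
    (A1 : forall t, set (noise1 M t)) (A2 : forall t, set (noise2 M t)) : R :=
  (\prod_(s < T.+1) Pr P (rW prim s @^-1` AW s)) *
  (\prod_(s < T.+1) Pr P (rV1 prim s @^-1` A1 s)) *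
  (\prod_(s < T.+1) Pr P (rV2 prim s @^-1` A2 s)).

Lemma in_boxP (AW : forall t, set (dstb M t))
    (A1 : forall t, set (noise1 M t)) (A2 : forall t, set (noise2 M t)) w :
  in_box AW A1 A2 w <->
  [/\ forall s, (s <= T)%N -> AW s (rW prim s w),
      forall s, (s <= T)%N -> A1 s (rV1 prim s w) &
      forall s, (s <= T)%N -> A2 s (rV2 prim s w)].
Proof.
split=> [H|[HW H1 H2] s sT]; last by split; [exact: HW|exact: H1|exact: H2].
by split=> s sT; case: (H s sT).
Qed.

Lemma measurable_in_box (AW : forall t, set (dstb M t))
    (A1 : forall t, set (noise1 M t)) (A2 : forall t, set (noise2 M t)) :
  measurable [set w | in_box AW A1 A2 w].
Proof.
rewrite (_ : [set w | _] = \bigcap_(s in [set s | (s <= T)%N])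
   ((rW prim s @^-1` AW s) `&` (rV1 prim s @^-1` A1 s) `&`
    (rV2 prim s @^-1` A2 s))).
  apply: bigcap_measurableType => s _; apply: measurableI.
    by apply: measurableI; apply: fin_rv_preimage; [exact: fin_rv_W|exact: fin_rv_V1].
  by apply: fin_rv_preimage; exact: fin_rv_V2.
apply/seteqP; split=> w H s sT; first by have [] := H s sT.
by have [[]] := H s sT.
Qed.

Lemma Pr_initial_in_box (AW : forall t, set (dstb M t))
    (A1 : forall t, set (noise1 M t)) (A2 : forall t, set (noise2 M t)) x :
  Pr P [set w | rX0 prim w = x /\ in_box AW A1 A2 w] = mass P (rX0 prim) x * box_mass AW A1 A2.
Proof.
have := primitives_independent prim [set x] AW A1 A2.
by rewrite !big_split.
Qed.

Lemma box_mass_setT : box_mass (fun _ => setT) (fun _ => setT) (fun _ => setT) = 1.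
Proof.
rewrite /box_mass !big1 ?mulr1 // => s _; rewrite preimage_setT; exact: Pr_setT.
Qed.

(** The future is tested by boxes that constrain W_s only for s >= t and V_s only
for s > t.  Quantifying over all of them, and not only over the next
disturbances, is what makes the property inductive. *)
Definition past_independent t := forall z AW A1 A2,
  (forall s, (s < t)%N -> AW s = setT) ->
  (forall s, (s <= t)%N -> A1 s = setT) ->
  (forall s, (s <= t)%N -> A2 s = setT) ->
  Pr P [set w | Z t w = z /\ in_box AW A1 A2 w] =
  mass P (Z t) z * box_mass AW A1 A2.

(** It suffices to check independence on a finer finite variable D.  The initial
draw and the one-step draw serve as D: the event D = q is a value of the
previous process variable together with a box. *)
Lemma past_independent_factor t (Q : finType) (D : Omega -> Q)
    (F : Q -> state M t * priv M t * Defs.mem2 M t) :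
  fin_rv D -> (forall w, Z t w = F (D w)) ->
  (forall q AW A1 A2,
     (forall s, (s < t)%N -> AW s = setT) ->
     (forall s, (s <= t)%N -> A1 s = setT) ->
     (forall s, (s <= t)%N -> A2 s = setT) ->
     Pr P [set w | D w = q /\ in_box AW A1 A2 w] =
     mass P D q * box_mass AW A1 A2) ->
  past_independent t.
Proof.
move=> mD /funext ZE H z AW A1 A2 hW h1 h2.
rewrite ZE mass_comp // mulr_suml.
under [RHS]eq_bigr => q _ do rewrite -(H q) //.
rewrite -(Pr_split P (fun q => F q == z) mD (measurable_in_box _ _ _)).
congr Pr.
by apply/seteqP; split=> w /= [/eqP].
Qed.

(** The proportionality of joint masses to box masses identifies the factor, by
taking the trivial box. *)
Lemma mass_of_box (Q : finType) (D : Omega -> Q) q c :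
  (forall AW A1 A2, AW = (fun _ => setT) -> A1 = (fun _ => setT) ->
     A2 = (fun _ => setT) ->
     Pr P [set w | D w = q /\ in_box AW A1 A2 w] = c * box_mass AW A1 A2) ->
  mass P D q = c.
Proof.
move=> H; rewrite -[c]mulr1 -box_mass_setT -H //; congr Pr.
by apply/seteqP; split=> w //= [].
Qed.

Lemma initial_past_independent : past_independent 0.
Proof.
have H q AW A1 A2 :
    (forall s, (s <= 0)%N -> A1 s = setT) ->
    (forall s, (s <= 0)%N -> A2 s = setT) ->
    Pr P [set w | initial_draw w = q /\ in_box AW A1 A2 w] =
    mass P (rX0 prim) q.1.1 * mass P (rV1 prim 0) q.1.2 *
    mass P (rV2 prim 0) q.2 * box_mass AW A1 A2.
  case: q => -[x v1] v2 /= h1 h2.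
  have := Pr_initial_in_box AW (dfwith A1 0 [set v1]) (dfwith A2 0 [set v2]) x.
  rewrite /box_mass !pin_coordinate_prod ?h1 ?h2 // => e.
  rewrite (_ : [set w | _ /\ _] = [set w | rX0 prim w = x /\
      in_box AW (dfwith A1 0 [set v1]) (dfwith A2 0 [set v2]) w]).
    by rewrite e; ring.
  apply/seteqP; split=> w /=.
    move=> [[<- <- <-] /in_boxP[HW H1 H2]]; split=> //.
    by apply/in_boxP; split=> //; apply/pin_coordinate_event; rewrite ?h1 ?h2.
  move=> [<-] /in_boxP[HW /pin_coordinate_event[]]; rewrite ?h1 // => <- H1.
  move=> /pin_coordinate_event[]; rewrite ?h2 // => <- H2.
  by split=> //; apply/in_boxP.
apply: (@past_independent_factor 0 _ _ initial fin_rv_initial_draw); first by [].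
move=> q AW A1 A2 _ h1 h2; rewrite H //; congr (_ * _); apply: esym.
by apply: mass_of_box => ? ? ? _ -> ->; exact: H.
Qed.


Definition draw_mass t (q : outcome M t * Defs.mem2 M t) : R :=
  let: (xl, a, v1, v2, m) := q in
  mass P (Z t) (xl, m) * mass P (rW prim t) a *
  mass P (rV1 prim t.+1) v1 * mass P (rV2 prim t.+1) v2.

Lemma Pr_draw_in_box t q AW A1 A2 :
  (t < T)%N -> past_independent t ->
  (forall s, (s <= t)%N -> AW s = setT) ->
  (forall s, (s <= t.+1)%N -> A1 s = setT) ->
  (forall s, (s <= t.+1)%N -> A2 s = setT) ->
  Pr P [set w | draw t w = q /\ in_box AW A1 A2 w] =
  draw_mass q * box_mass AW A1 A2.
Proof.
case: q => -[[[xl a] v1] v2] m tT ind hW h1 h2.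
have tT' := ltnW tT.
have := ind (xl, m) (dfwith AW t [set a]) (dfwith A1 t.+1 [set v1])
  (dfwith A2 t.+1 [set v2]).
rewrite /box_mass !pin_coordinate_prod ?hW ?h1 ?h2 // => e.
rewrite (_ : [set w | _ /\ _] = [set w | Z t w = (xl, m) /\
    in_box (dfwith AW t [set a]) (dfwith A1 t.+1 [set v1])
      (dfwith A2 t.+1 [set v2]) w]); last first.
  apply/seteqP; split=> w /=.
    move=> [[zE aE v1E v2E mE] /in_boxP[HW H1 H2]]; split.
      by rewrite -zE -mE; case: (Z t w).
    by apply/in_boxP; split=> //; apply/pin_coordinate_event; rewrite ?hW ?h1 ?h2.
  rewrite /draw => -[-> /in_boxP[/pin_coordinate_event[]]]; rewrite ?hW // => -> HW.
  move=> /pin_coordinate_event[]; rewrite ?h1 // => -> H1.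
  move=> /pin_coordinate_event[]; rewrite ?h2 // => -> H2.
  by split=> //; apply/in_boxP.
rewrite e; first by rewrite /draw_mass; ring.
- by move=> s st; rewrite dfwithout ?hW ?gtn_eqF // ltnW.
- by move=> s st; rewrite dfwithout ?h1 ?gtn_eqF // ltnW.
- by move=> s st; rewrite dfwithout ?h2 ?gtn_eqF // ltnW.
Qed.

Lemma mass_draw_of_past t q :
  (t < T)%N -> past_independent t -> mass P (draw t) q = draw_mass q.
Proof.
move=> tT ind; apply: mass_of_box => AW A1 A2 -> -> ->.
exact: Pr_draw_in_box.
Qed.

Lemma process_past_independent t : (t <= T)%N -> past_independent t.
Proof.
elim: t => [_|t IH tT]; first exact: initial_past_independent.
have ind := IH (ltnW tT).
apply: (past_independent_factor (@fin_rv_draw t) (process_succ t)).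
move=> q AW A1 A2 hW h1 h2.
by rewrite mass_draw_of_past //; exact: Pr_draw_in_box.
Qed.

Lemma mass_draw t q : (t < T)%N -> mass P (draw t) q = draw_mass q.
Proof.
by move=> tT; apply: mass_draw_of_past => //; exact: process_past_independent (ltnW tT).
Qed.

(** * Beliefs along the process *)

Definition mem_mass t (m : Defs.mem2 M t) : R :=
  \sum_xl mass P (Z t) (xl, m).

Lemma belief2_atE t m :
  belief2_at m = normalize (dflt2 t) (fun xl => mass P (Z t) (xl, m)).
Proof.
rewrite /belief2_at cond_distE; first last.
- exact: (fin_rv_comp snd (@fin_rv_process t)).
- exact: (fin_rv_comp fst (@fin_rv_process t)).
congr normalize; apply/funext => xl; congr (mass P _ _).
by apply/funext => w; case: (Z t w).
Qed.

Lemma mass_processE t xl m :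
  mass P (Z t) (xl, m) = mem_mass m * belief2_at m xl.
Proof.
by rewrite belief2_atE /mem_mass -normalizeM // => a; exact: mass_ge0.
Qed.

(** On a memory m of positive probability, the joint mass x |-> P(x, l, m) is
P(m) times x |-> pi_m(x, l), so both conditionings on l give the same result,
even if the value l itself is null. *)
Lemma belief1_atE t l m : mem_mass m != 0 ->
  belief1_at (l, m) = e_map dflt1 (@belief2_at t m) l.
Proof.
move=> m0; rewrite /belief1_at cond_distE; first last.
- exact: (fin_rv_comp (fun z => (z.1.2, z.2)) (@fin_rv_process t)).
- exact: (fin_rv_comp (fun z => z.1.1) (@fin_rv_process t)).
apply: (@normalizeZ _ _ _ (mem_mass m)) => // x; rewrite -mass_processE.
by congr Pr; apply/seteqP; split=> w /=; case: (Z t w) => [[x' l'] m'] /= [-> -> ->].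
Qed.

(** The prescription that agent 2 would announce at memory m; it turns the law of
agent 1, which depends on both beliefs, into a decision of the dynamic
program. *)
Definition prescription_at t (m : Defs.mem2 M t) : prescription M t :=
  fun pi1 => law1 g pi1 (belief2_at m).

Lemma draw_massE t (o : outcome M t) m :
  draw_mass (o, m) = mem_mass m * outcome_mass prim (belief2_at m) o.
Proof. by case: o => [[[[x l] a] v1] v2] /=; rewrite mass_processE !mulrA. Qed.

(** Any average over the realized draw is an average over memories of averages
in the one-step experiment, by independence and the definition of pi_m. *)
Lemma sum_draw t (f : outcome M t * Defs.mem2 M t -> R) : (t < T)%N ->
  \sum_q mass P (draw t) q * f q =
  \sum_m mem_mass m * \sum_o outcome_mass prim (belief2_at m) o * f (o, m).
Proof.
move=> tT; under eq_bigr do rewrite mass_draw //.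
rewrite (eq_bigr (fun q => mem_mass q.2 *
    (outcome_mass prim (belief2_at q.2) q.1 * f (q.1, q.2)))).
  rewrite -(pair_bigA _ (fun o m => mem_mass m *
    (outcome_mass prim (belief2_at m) o * f (o, m)))) /= exchange_big.
  by apply: eq_bigr => m _; rewrite mulr_sumr.
by move=> [q m] _; rewrite draw_massE mulrA.
Qed.

Lemma transitionE t (o : outcome M t) (m : Defs.mem2 M t) : mem_mass m != 0 ->
  let pi2 := belief2_at m in
  let gamma := prescription_at m in
  let u2 := law2 g pi2 in
  transition (o, m) =
    (step_state dflt1 pi2 gamma u2 o, step_priv dflt1 pi2 gamma u2 o,
     (m, (step_Z2 dflt1 pi2 gamma u2 o).2, (step_Z2 dflt1 pi2 gamma u2 o).1)).
Proof.
move=> m0; case: o => [[[[x l] a] v1] v2] /=.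
by rewrite /prescription_at -belief1_atE.
Qed.

(* Otherwise /= unfolds transitions and hides the pattern of [transition_mem]. *)
#[local] Arguments transition : simpl never.

Lemma transition_mem t (o : outcome M t) m : (transition (o, m)).2.1.1 = m.
Proof. by case: o => [[[[x l] a] v1] v2]. Qed.

Lemma mass_process_step t (m : Defs.mem2 M t) y xl : (t < T)%N ->
  mem_mass m != 0 ->
  let pi2 := belief2_at m in
  let gamma := prescription_at m in
  let u2 := law2 g pi2 in
  mass P (Z t.+1) (xl, (m, u2, y)) =
  mem_mass m * \sum_(o | ((step_state dflt1 pi2 gamma u2 o,
                          step_priv dflt1 pi2 gamma u2 o) == xl) &&
                         (step_Z2 dflt1 pi2 gamma u2 o == (y, u2)))
                outcome_mass prim pi2 o.
Proof.
move=> tT m0 pi2 gamma u2.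
rewrite (_ : Z t.+1 = fun w => transition (draw t w)); last first.
  by apply/funext => w; exact: process_succ.
rewrite mass_comp; last exact: fin_rv_draw.
rewrite big_mkcond /=.
rewrite (eq_bigr (fun q => mass P (draw t) q *
    (transition q == (xl, (m, u2, y)))%:R)); last first.
  by move=> q _; case: eqP; rewrite ?mulr1 ?mulr0.
rewrite sum_draw // (bigD1 m) //= [X in _ + X]big1 ?addr0; last first.
  (* The next memory contains the current one, so no other memory leads there. *)
  move=> m' mm'; rewrite big1 ?mulr0 // => o _.
  case: eqP => [e|_]; last by rewrite mulr0.
  by have := transition_mem o m'; rewrite e => mE; rewrite -mE eqxx in mm'.
congr (_ * _); rewrite [RHS]big_mkcond /=; apply: eq_bigr => o _.
rewrite transitionE // -/pi2 -/gamma -/u2.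
case: (step_Z2 _ _ _ _ o) => y' u' /=; rewrite !xpair_eqE eqxx /=.
by rewrite [(u' == _) && _]andbC; case: ifP; rewrite ?mulr1 ?mulr0.
Qed.

(** By [mass_process_step] the joint mass of the next state and private history
with the memory (m, u2, y) is P(m) times the same mass in the experiment, so
the two posteriors coincide. *)
Lemma belief2_step t (m : Defs.mem2 M t) (o : outcome M t) : (t < T)%N ->
  mem_mass m != 0 ->
  belief2_at (transition (o, m)).2 =
  step_info2 dflt1 dflt2 prim (belief2_at m) (prescription_at m)
    (law2 g (belief2_at m)) o.
Proof.
move=> tT m0; rewrite transitionE //= belief2_atE /step_info2 fin_cond_distE.
set z := step_Z2 _ _ _ _ o.
have -> : z = (z.1, law2 g (belief2_at m)).
  by rewrite /z; case: o {z} => [[[[x l] a] v1] v2].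
apply: (@normalizeZ _ _ _ (mem_mass m)) => // xl.
by rewrite mass_process_step.
Qed.

Lemma sum_process_mem t (f : Defs.mem2 M t -> R) :
  \sum_z mass P (Z t) z * f z.2 = \sum_m mem_mass m * f m.
Proof.
rewrite (eq_bigr (fun z => mass P (Z t) (z.1, z.2) * f z.2)); last first.
  by case.
rewrite -(pair_bigA _ (fun xl m => mass P (Z t) (xl, m) * f m)) exchange_big /=.
by apply: eq_bigr => m _; rewrite mulr_suml.
Qed.

(** Information-state property: the law of the next belief depends on the
current memory only through the current belief, the prescription and u2. *)
Lemma next_value_step_expect t (J : info2 M t.+1 -> R) : (t < T)%N ->
  \sum_m mem_mass m * J (@belief2_at t.+1 m) =
  \sum_m mem_mass m *
    step_expect dflt1 dflt2 prim (@belief2_at t m) (prescription_at m)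
      (law2 g (belief2_at m)) J.
Proof.
move=> tT; rewrite -(sum_process_mem (fun m => J (belief2_at m))).
rewrite (_ : Z t.+1 = fun w => transition (draw t w)); last first.
  by apply/funext => w; exact: process_succ.
rewrite (sum_mass_comp P _ (fun z => J (belief2_at z.2))); last exact: fin_rv_draw.
rewrite sum_draw //; apply: eq_bigr => m _.
have [->|m0] := eqVneq (mem_mass m) 0; first by rewrite !mul0r.
by congr (_ * _); apply: eq_bigr => o _; rewrite belief2_step.
Qed.

(** * The one-stage cost identity *)

Definition stage_cost t : R := \sum_z mass P (Z t) z *
  cost z.1.1 (law1 g (belief1_at (z.1.2, z.2)) (belief2_at z.2))
    (law2 g (belief2_at z.2)).

(** Averaging the cost over the posterior e_t(pi2, l) and then over l is the
same as averaging it over pi2, by the tower rule. *)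
Lemma ctilde2E t (pi2 : info2 M t) (gamma : prescription M t) (u2 : act2 M t) :
  ctilde2 dflt1 pi2 gamma u2 =
  \sum_(xl : state M t * priv M t)
    pi2 xl * cost xl.1 (gamma (e_map dflt1 pi2 xl.2)) u2.
Proof.
have swap (F : state M t -> priv M t -> R) :
    \sum_(xl : state M t * priv M t) F xl.1 xl.2 = \sum_l \sum_x F x l.
  by rewrite -(pair_bigA _ F) exchange_big.
pose u1 l := gamma (e_map dflt1 pi2 l).
rewrite /ctilde2 (eq_bigr (fun xl => pi2 (xl.1, xl.2) *
  ctilde1 (e_map dflt1 pi2 xl.2) (u1 xl.2) u2)); last by case.
rewrite [RHS](eq_bigr (fun xl => pi2 (xl.1, xl.2) * cost xl.1 (u1 xl.2) u2));
  last by case.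
rewrite (swap (fun x l => pi2 (x, l) * ctilde1 (e_map dflt1 pi2 l) (u1 l) u2)).
rewrite (swap (fun x l => pi2 (x, l) * cost x (u1 l) u2)).
apply: eq_bigr => l _; rewrite -mulr_suml /ctilde1 mulr_sumr.
apply: eq_bigr => x _; rewrite mulrA; congr (_ * _); apply: esym.
exact: (normalizeM (dflt1 t) x (fun x => dist_ge0 pi2 (x, l))).
Qed.

Lemma stage_costE t : stage_cost t =
  \sum_m mem_mass m *
    ctilde2 dflt1 (@belief2_at t m) (prescription_at m) (law2 g (belief2_at m)).
Proof.
rewrite /stage_cost (eq_bigr (fun z => mass P (Z t) (z.1, z.2) *
  cost z.1.1 (law1 g (belief1_at (z.1.2, z.2)) (belief2_at z.2))
    (law2 g (belief2_at z.2)))); last by case.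
rewrite -(pair_bigA _ (fun xl m => mass P (Z t) (xl, m) *
  cost xl.1 (law1 g (belief1_at (xl.2, m)) (belief2_at m))
    (law2 g (belief2_at m)))) exchange_big /=.
apply: eq_bigr => m _; rewrite ctilde2E mulr_sumr; apply: eq_bigr => -[x l] _ /=.
rewrite mass_processE -mulrA.
have [->|m0] := eqVneq (mem_mass m) 0; first by rewrite !mul0r.
by rewrite belief1_atE.
Qed.

(** The identity that couples the process to the dynamic program; it holds for
every profile and every continuation J, optimal or not. *)
Lemma stage_bellman t (J : info2 M t.+1 -> R) : (t < T)%N ->
  stage_cost t + \sum_m mem_mass m * J (@belief2_at t.+1 m) =
  \sum_m mem_mass m *
    bellman dflt1 dflt2 prim (@belief2_at t m) (prescription_at m)
      (law2 g (belief2_at m)) J.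
Proof.
move=> tT; rewrite stage_costE next_value_step_expect // -big_split /=.
by apply: eq_bigr => m _; rewrite mulrDr.
Qed.

Lemma mem_mass_ge0 t (m : Defs.mem2 M t) : 0 <= mem_mass m.
Proof. by apply: sumr_ge0 => xl _; exact: mass_ge0. Qed.

Lemma cost_to_goE t :
  cost_to_go dflt1 dflt2 prim g t = (\sum_(t <= l < T.+1) stage_cost l)%:E.
Proof.
exact: (expectation_sum_fin_rv P (fun l z =>
  cost z.1.1 (law1 g (belief1_at (z.1.2, z.2)) (belief2_at z.2))
    (law2 g (belief2_at z.2))) t T.+1 fin_rv_process).
Qed.

Lemma expectation_Pi2 t (J : info2 M t -> R) :
  ('E_P[fun w => J (Pi2 dflt1 dflt2 prim g t w)] =
   (\sum_m mem_mass m * J (belief2_at m))%:E)%E.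
Proof.
rewrite -sum_process_mem.
exact: (expectation_fin_rv P (fun z => J (belief2_at z.2)) (@fin_rv_process t)).
Qed.

End Process.

(** * Backward induction *)

(** A bare infimum over the reals is only meaningful for sets bounded below;
having a minimizer settles this too, so the infinite set of prescriptions needs
no separate treatment. *)
Lemma inf_minimizer (R : realType) (A : Type) (F : A -> R) a :
  minimizer F a -> inf (range F) = F a.
Proof.
move=> Fa; apply/eqP; rewrite eq_le; apply/andP; split.
  by apply: ge_inf; [exists (F a) => _ [b _ <-]; exact: Fa|exists a].
by apply: lb_le_inf; [exists (F a), a|move=> _ [b _ <-]; exact: Fa].
Qed.

Section BackwardInduction.
Variables (R : realType) (M : team R).
Variables (dflt1 : forall t, info1 M t) (dflt2 : forall t, info2 M t).
Variables (d : measure_display) (Omega : measurableType d).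
Variables (P : probability Omega R) (prim : primitives M P).
Variables (psi : forall t, info2 M t -> prescription M t).
Variables (gT : info1 M (horizon M) -> act2 M (horizon M) -> act1 M (horizon M)).
Variable gs : profile M.
Hypothesis hgs : dp_solution dflt1 dflt2 prim psi gT gs.

Local Notation T := (horizon M).
Local Notation value t := (@value R M dflt1 dflt2 d Omega P prim t).
Local Notation mem_mass := (mem_mass dflt1 dflt2 prim).
Local Notation belief2_at := (belief2_at dflt1 dflt2 prim).
Local Notation stage_cost := (stage_cost dflt1 dflt2 prim).

Lemma value_optimal t (pi2 : info2 M t) : (t < T)%N ->
  value t pi2 = bellman dflt1 dflt2 prim pi2 (psi pi2) (law2 gs pi2) (value t.+1).
Proof.
move=> tT; have := inf_minimizer (dp_stage hgs pi2 tT) => /= <-.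
by rewrite /Defs.value -(subnSK tT).
Qed.

Lemma value_le_bellman t (pi2 : info2 M t) gamma u2 : (t < T)%N ->
  value t pi2 <= bellman dflt1 dflt2 prim pi2 gamma u2 (value t.+1).
Proof.
by move=> tT; rewrite value_optimal //; exact: (dp_stage hgs pi2 tT (gamma, u2)).
Qed.

Lemma term_value1_optimal (pi1 : info1 M T) u2 :
  term_value1 pi1 u2 = ctilde1 pi1 (gT pi1 u2) u2.
Proof. exact: inf_minimizer (dp_term1 hgs pi1 u2). Qed.

Lemma value_term_optimal (pi2 : info2 M T) :
  value T pi2 = term_expect dflt1 pi2 (law2 gs pi2).
Proof. by rewrite /Defs.value subnn; exact: inf_minimizer (dp_term2 hgs pi2). Qed.

(** At the horizon agent 1 reacts to u2 pointwise in its belief, and its best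
reaction beats any prescription. *)
Lemma value_term_le_ctilde2 (pi2 : info2 M T) gamma u2 :
  value T pi2 <= ctilde2 dflt1 pi2 gamma u2.
Proof.
rewrite value_term_optimal; apply: le_trans (dp_term2 hgs pi2 u2) _.
apply: ler_sum => xl _; rewrite ler_wpM2l ?dist_ge0 // term_value1_optimal.
exact: (dp_term1 hgs).
Qed.

Definition expected_value (g : profile M) t : R :=
  \sum_m mem_mass g m * value t (belief2_at g m).

Lemma expected_value_le_cost g k t : (t + k)%N = T ->
  expected_value g t <= \sum_(t <= l < T.+1) stage_cost g l.
Proof.
elim: k t => [|k IH] t.
  rewrite addn0 => ->; rewrite big_nat1 stage_costE; apply: ler_sum => m _.
  by rewrite ler_wpM2l ?mem_mass_ge0 // value_term_le_ctilde2.
move=> tk; have tT : (t < T)%N by rewrite -tk addnS ltnS leq_addr.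
rewrite big_ltn ?(ltnW tT) //; last by rewrite ltnS ltnW.
apply: le_trans (lerD (lexx _) (IH t.+1 _)); last by rewrite addSnnS.
rewrite stage_bellman //; apply: ler_sum => m _.
by rewrite ler_wpM2l ?mem_mass_ge0 // value_le_bellman.
Qed.

(** The inequalities behind [expected_value_le_cost] are equalities when the
remaining laws are optimal; the earlier laws of g are unconstrained. *)
Lemma expected_value_eq_cost g k t : (t + k)%N = T ->
  (forall l, (t <= l)%N ->
     @law1 _ _ g l = @law1 _ _ gs l /\ @law2 _ _ g l = @law2 _ _ gs l) ->
  expected_value g t = \sum_(t <= l < T.+1) stage_cost g l.
Proof.
elim: k t => [|k IH] t.
  rewrite addn0 => -> H; have [H1 H2] := H T (leqnn T).
  rewrite big_nat1 stage_costE; apply: eq_bigr => m _; congr (_ * _).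
  rewrite value_term_optimal H2; apply: eq_bigr => xl _; congr (_ * _).
  by rewrite term_value1_optimal /prescription_at H1 (dp_law1_term hgs).
move=> tk H; have tT : (t < T)%N by rewrite -tk addnS ltnS leq_addr.
have [H1 H2] := H t (leqnn t).
rewrite big_ltn; last by rewrite ltnS ltnW.
rewrite -(IH t.+1); [|by rewrite addSnnS|by move=> l /ltnW; exact: H].
rewrite stage_bellman //; apply: eq_bigr => m _; congr (_ * _).
rewrite value_optimal // H2; congr bellman; apply/funext => pi1.
by rewrite /prescription_at H1 (dp_law1 hgs).
Qed.

End BackwardInduction.

(** Beliefs are computed from the law of the process, but at time t only the laws
before t enter this law; hence a splice at time t leaves Pi^2_t unchanged. *)
Lemma process_ext (R : realType) (M : team R)
    (dflt1 : forall t, info1 M t) (dflt2 : forall t, info2 M t)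
    (d : measure_display) (Omega : measurableType d)
    (P : probability Omega R) (prim : primitives M P) (g g' : profile M) t :
  (forall l, (l < t)%N ->
     @law1 _ _ g l = @law1 _ _ g' l /\ @law2 _ _ g l = @law2 _ _ g' l) ->
  process dflt1 dflt2 prim g t = process dflt1 dflt2 prim g' t.
Proof.
elim: t => [//|t IH] H; have [H1 H2] := H t (ltnSn t).
by rewrite /= IH ?H1 ?H2 // => l /ltnW; exact: H.
Qed.

Theorem theorem3 (R : realType) (M : team R)
    (dflt1 : forall t, info1 M t) (dflt2 : forall t, info2 M t)
    (d : measure_display) (Omega : measurableType d)
    (P : probability Omega R) (prim : primitives M P)
    (psi : forall t, info2 M t -> prescription M t)
    (gT : info1 M (horizon M) -> act2 M (horizon M) -> act1 M (horizon M))
    (gs : profile M)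
    (hgs : dp_solution dflt1 dflt2 prim psi gT gs)
    (t : nat) (ht : (t < horizon M)%N) :
  (forall g : profile M,
     ('E_P[fun w => value dflt1 dflt2 prim (Pi2 dflt1 dflt2 prim g t w)]
        <= cost_to_go dflt1 dflt2 prim g t)%E) /\
  (forall g : profile M,
     (cost_to_go dflt1 dflt2 prim (splice t g gs) t =
      'E_P[fun w => value dflt1 dflt2 prim (Pi2 dflt1 dflt2 prim g t w)])%E).
Proof.
have tk : (t + (horizon M - t))%N = horizon M by rewrite subnKC // ltnW.
split=> g.
  rewrite expectation_Pi2 cost_to_goE lee_fin.
  exact: (expected_value_le_cost hgs g tk).
have -> : Pi2 dflt1 dflt2 prim g t = Pi2 dflt1 dflt2 prim (splice t g gs) t.
  rewrite /Pi2 (@process_ext _ _ _ _ _ _ _ _ g (splice t g gs)) //.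
  by move=> l lt; rewrite /= lt.
rewrite expectation_Pi2 cost_to_goE; congr EFin; apply: esym.
apply: (expected_value_eq_cost hgs tk) => l tl /=.
by rewrite ltnNge tl.
Qed.
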